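(* The Boolean functions on $\mathbb{F}_2^8$ $$f_{8,5}=x_0x_1x_2+x_0x_6+x_1x_3x_4+x_1x_4+x_1x_5+x_2x_3x_5+x_2x_4+x_3x_7$$ and $$f_{8,6}=x_0x_1x_2+x_0x_2+x_0x_3+x_1x_3x_4+x_1x_6+x_2x_3x_5+x_2x_4+x_5x_7$$ are general linear equivalent, i.e. there exists $A\in GL(8,2)$ with $f_{8,6}(x)=f_{8,5}(Ax)$ for all $x\in\mathbb{F}_2^8$.
   Context: Polynomials are in algebraic normal form over $\mathbb{F}_2$ in variables $x_0,\dots,x_7$. *)

(* Defs.v *)
From mathcomp Require Import all_boot all_order all_algebra.

Set Implicit Arguments.
Unset Strict Implicit.
Unset Printing Implicit Defensive.

Import GRing.Theory.
Local Open Scope ring_scope.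

Definition boolfun (n : nat) := 'cV['F_2]_n -> 'F_2.

Definition gl_equivalent (n : nat) (f g : boolfun n) : Prop :=
  exists2 A : 'M['F_2]_n, A \in unitmx & forall x : 'cV['F_2]_n, g x = f (A *m x).

(* The variable x_k of x; [inord k : 'I_8] has value k for all k < 8. *)
Local Notation "x # k" := (x (inord k%N) 0) (at level 2, format "x # k").

Definition f85 : boolfun 8 := fun x =>
  x#0 * x#1 * x#2 + x#0 * x#6 + x#1 * x#3 * x#4 + x#1 * x#4
  + x#1 * x#5 + x#2 * x#3 * x#5 + x#2 * x#4 + x#3 * x#7.

Definition f86 : boolfun 8 := fun x =>
  x#0 * x#1 * x#2 + x#0 * x#2 + x#0 * x#3 + x#1 * x#3 * x#4
  + x#1 * x#6 + x#2 * x#3 * x#5 + x#2 * x#4 + x#5 * x#7.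

(* Main.v *)
(** The equivalence is a renaming of the variables:
    [(0 5 4)(1 2 3)(6 7)] carries the monomials of [f85] to those of [f86]. *)
Require Import Defs.
From mathcomp Require Import all_boot all_order all_algebra.
From mathcomp Require Import perm ring.

Import GRing.Theory.
Local Open Scope ring_scope.

(** Both functions have the same cubic part, whose monomials the renaming cycles: x0x1x2 to x2x3x5
    to x1x3x4 and back. The quadratic monomials x0x6, x1x4, x1x5, x2x4, x3x7 go to x5x7, x0x2, x2x4,
    x0x3, x1x6. *)

Definition renaming : seq nat := [:: 5; 2; 3; 1; 0; 4; 7; 6]%N.

Lemma renaming_lt (k : nat) : (nth 0 renaming k < 8)%N.
(* Past the list, [nth] returns its default 0, still below 8. *)
Proof. by do 8! [case: k => [|k] //]; rewrite nth_default. Qed.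

Lemma renaming_inj : injective (fun i : 'I_8 => inord (nth 0%N renaming i) : 'I_8).
Proof.
move=> i j /(congr1 val) /=; rewrite !inordK ?renaming_lt // => /eqP.
by rewrite nth_uniq // => /eqP /val_inj.
Qed.

Theorem mainTheorem9 : gl_equivalent f85 f86.
Proof.
exists (perm_mx (perm renaming_inj)) => [|x]; first exact: unitmx_perm.
(* Entry k of [perm_mx s *m x] is entry [s k] of [x], so [s] itself, not its inverse, renames the
   indices; the two sides then differ only in the order of terms and factors. *)
by rewrite -row_permE /f85 /f86 !mxE !permE !inordK //=; ring.
Qed.
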